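(* Let $k>2$ be a natural number. The $k$-element cycle $C_k$ is point-by-point retractable if and only if $k<5$. It is sociable if and only if $k=3$.
   Context: A graph is a pair $(V,E)$ where $E$ is a symmetric and reflexive binary relation on $V$ (every vertex has a loop; in particular all vertices of $C_k$ carry loops). A homomorphism is an edge-preserving map (it may collapse edges). A retraction of $X$ onto $Y\subseteq X$ is a homomorphism $X\to Y$ (with $Y$ the induced subgraph) that is the identity on $Y$; then $Y$ is a retract of $X$. A graph $X$ is point-by-point retractable (PPR) if $X=\bigcup_{n\in\omega}X_n$ where the $X_n$ are induced subgraphs, $|X_0|=1$, $X_n\subseteq X_{n+1}$, $|X_{n+1}\setminus X_n|\leq 1$, and $X_n$ is a retract of $X_{n+1}$ for each $n\in\omega$. A graph $X$ is sociable if $X=\bigcup_{n\in\omega}X_n$ where the $X_n$ are induced subgraphs, $|X_0|=1$, $X_n\subseteq X_{n+1}$, $|X_{n+1}\setminus X_n|\leq 1$, and for each $n$ there is a retraction $p_n$ of $X_{n+1}$ onto $X_n$ such that, if $X_{n+1}\setminus X_n=\{w\}$, then $w$ is adjacent to $p_n(w)$. *)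

(* Defs.v *)
From mathcomp Require Import all_boot.
From mathcomp Require Import mathcomp_extra boolp classical_sets functions cardinality.

Set Implicit Arguments.
Unset Strict Implicit.
Unset Printing Implicit Defensive.

Local Open Scope classical_set_scope.
Local Open Scope card_scope.

Record graph := Graph {
  vertex :> Type;
  edge : vertex -> vertex -> Prop;
  edge_refl : forall x, edge x x;
  edge_sym : forall x y, edge x y -> edge y x
}.

Arguments edge {g}.

(* Induced subgraphs of X are given by their vertex sets, and a map from the
   subgraph A to the subgraph B is given by a total function on X, whose values
   outside A are irrelevant. *)
Definition homomorphism (X : graph) (A B : set X) (p : X -> X) : Prop :=
  set_fun A B p /\ forall x y, A x -> A y -> edge x y -> edge (p x) (p y).

Definition retraction (X : graph) (A B : set X) (p : X -> X) : Prop :=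
  [/\ B `<=` A, homomorphism A B p & forall y, B y -> p y = y].

Definition retract (X : graph) (A B : set X) : Prop :=
  exists p : X -> X, retraction A B p.

(* `I_1 is the one-element set {0} of natural numbers. *)
Definition point_by_point (X : graph) (F : nat -> set X) : Prop :=
  [/\ \bigcup_n F n = [set: X],
      F 0 #= `I_1,
      forall n, F n `<=` F n.+1
    & forall n, F n.+1 `\` F n #<= `I_1].

Definition PPR (X : graph) : Prop :=
  exists F : nat -> set X,
    point_by_point F /\ forall n, retract (F n.+1) (F n).

Definition sociable (X : graph) : Prop :=
  exists F : nat -> set X,
    point_by_point F /\
    forall n, exists p : X -> X,
      retraction (F n.+1) (F n) p /\
      forall w, F n.+1 `\` F n = [set w] -> edge w (p w).

(* ordS is the cyclic successor i |-> i + 1 mod k on 'I_k. *)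
Definition cycle_edge (k : nat) (i j : 'I_k) : Prop :=
  [\/ i = j, j = ordS i | i = ordS j].

Lemma cycle_edge_refl (k : nat) (i : 'I_k) : cycle_edge i i.
Proof. exact: Or31. Qed.

Lemma cycle_edge_sym (k : nat) (i j : 'I_k) : cycle_edge i j -> cycle_edge j i.
Proof. by case=> ->; [exact: Or31 | exact: Or33 | exact: Or32]. Qed.

Definition cycle_graph (k : nat) : graph :=
  Graph (@cycle_edge_refl k) (@cycle_edge_sym k).

(* Main.v *)
Require Import Defs.
From mathcomp Require Import all_boot.
From mathcomp Require Import boolp classical_sets functions cardinality zify.

(** The last point [w] to enter a filtration of [C_k] must be sent by the
    retraction to a point other than [w] that is adjacent to both neighbours of
    [w].  For [k > 4] there is no such point, and for [k = 4] the only one is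
    [w + 2], which is not adjacent to [w].  Conversely, for [k < 5] the initial
    segments [{0, ..., n}] form a filtration in which [n + 1] folds to [1] (to
    [0] if [n = 0]), and [C_3] is complete. *)

Set Implicit Arguments.
Unset Strict Implicit.
Unset Printing Implicit Defensive.

Local Open Scope classical_set_scope.
Local Open Scope card_scope.

Lemma val_ordS k (i : 'I_k) :
  ordS i = (if i.+1 == k then 0 else i.+1) :> nat.
Proof.
rewrite /=; case: eqP => [->|ne]; first by rewrite modnn.
by rewrite modn_small //; have := ltn_ord i; lia.
Qed.

(** Removes the modulus from adjacency, which brings the later case analyses within reach of
    [lia]. *)
Lemma cycle_edge_val k (i j : 'I_k) : cycle_edge i j <->
  (i = j :> nat) \/ (j = i.+1 :> nat) \/ (i = j.+1 :> nat) \/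
  (i.+1 = k /\ j = 0 :> nat) \/ (j.+1 = k /\ i = 0 :> nat).
Proof.
have edgeE : cycle_edge i j <->
    i = j :> nat \/ j = ordS i :> nat \/ i = ordS j :> nat.
  split=> [[->|->|->]|[/val_inj->|[/val_inj->|/val_inj->]]];
  by [auto | constructor 1 | constructor 2 | constructor 3].
rewrite edgeE !val_ordS; move: (ltn_ord i) (ltn_ord j).
by case: eqP; case: eqP; lia.
Qed.

(** Being different from [w], the point [q] lies in both {w + 1, w + 2} and {w - 1, w - 2}. For
    [k > 2] these sets meet only if [k] is 3 or 4, and for [k = 4] only in w + 2. *)
Lemma cycle_common_neighbour k (w q : 'I_k) : 2 < k -> q <> w ->
  cycle_edge q (ordS w) -> cycle_edge q (ord_pred w) ->
  k < 5 /\ (cycle_edge w q -> k = 3).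
Proof.
move=> k_gt2 q_neq_w; have {q_neq_w} : q <> w :> nat by move=> /val_inj.
(* The predecessor is described as the point whose successor is [w], which avoids its modular
   formula. *)
rewrite !cycle_edge_val val_ordS; have := val_ordS (ord_pred w).
rewrite ord_predK.
move: (ltn_ord w) (ltn_ord q) (ltn_ord (ord_pred w)).
move: (nat_of_ord (ord_pred w)) (nat_of_ord q) (nat_of_ord w) => v b a.
by case: eqP; case: eqP; lia.
Qed.

(** Choose for each point a stage containing it; the maximum of these finitely many stages contains
    them all. *)
Lemma nondecreasing_cover_finite (T : finType) (F : nat -> set T) :
  (forall n, F n `<=` F n.+1) -> \bigcup_n F n = setT ->
  exists n, F n = setT.
Proof.
move=> incF covF.
have [|f Ff] := @choice T nat (fun x n => F n x).
  by move=> x; have [n _ Fnx] : (\bigcup_n F n) x by [rewrite covF]; exists n.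
have monoF m n : m <= n -> F m `<=` F n.
  by move=> /subnK <-; elim: (n - m) => // d IH x /IH /incF.
exists (\max_x f x); apply/seteqP; split=> // x _.
exact: (monoF (f x) _ (leq_bigmax x)).
Qed.

Lemma card_le_I1_eq (T : Type) (A : set T) x y :
  A #<= `I_1 -> A x -> A y -> x = y.
Proof.
move=> /pcard_leP/unsquash f Ax Ay.
apply: (@inj _ _ _ f); rewrite ?inE //.
have := @funS _ _ _ _ f _ Ax; have := @funS _ _ _ _ f _ Ay.
by rewrite /=; lia.
Qed.

(** Descend from stage [n] to the first full stage. It is not stage 0, which has one point while [x]
    and [y] differ. *)
Lemma point_by_point_last (X : graph) (F : nat -> set X) (x y : X) n :
  x <> y -> point_by_point F -> F n = setT ->
  exists m w, F m.+1 = setT /\ F m.+1 `\` F m = [set w].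
Proof.
move=> x_neq_y [_ F0 _ dF] Fn.
elim: n Fn => [FT|n IH FT].
  case: x_neq_y; apply: (@card_le_I1_eq _ (F 0)); rewrite ?FT //.
  by rewrite -FT; move: F0; rewrite card_eq_le => /andP[].
have [/IH//|Fn_neqT] := pselect (F n = setT).
have [w nFw] : exists w, ~ F n w.
  by apply/existsNP => FnT; apply: Fn_neqT; apply/seteqP; split.
exists n, w; split=> //; apply/seteqP; split=> [z Dz|z ->]; last by rewrite FT.
by apply: (card_le_I1_eq (dF n) Dz); rewrite FT.
Qed.

(** Serves both [only if] directions: the step is fixed before the retraction [p], so [p] may come
    from either definition. *)
Lemma cycle_last_step k (F : nat -> set (cycle_graph k)) : 2 < k ->
  point_by_point F ->
  exists n w, F n.+1 `\` F n = [set w] /\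
    forall p, retraction (F n.+1) (F n) p ->
      k < 5 /\ (cycle_edge w (p w) -> k = 3).
Proof.
case: k F => [|[|k]] // F k_gt2 pbpF.
have [covF _ incF _] := pbpF.
have [N FN] := nondecreasing_cover_finite (T := 'I_k.+2) incF covF.
have ends_neq : (ord0 : 'I_k.+2) <> ord_max by [].
have [n [w [FT Dw]]] := point_by_point_last (X := cycle_graph k.+2) ends_neq pbpF FN.
exists n, w; split=> // p [_ [pF pE] pK].
have nFw : ~ F n w by have [] : (F n.+1 `\` F n) w by rewrite Dw.
have Fn z : z <> w -> F n z.
  move=> z_neq_w; apply: contrapT => nFz; apply: z_neq_w.
  by have : (F n.+1 `\` F n) z by [rewrite FT]; rewrite Dw.
have pw_neq_w : p w <> w.
  by move=> pw; apply: nFw; rewrite -pw; apply: pF; rewrite FT.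
(* Such a [z] is already in [F n], so [p] fixes it and carries the edge from [w] to [z] to one from
   [p w] to [z]. *)
have pw_adj z : z <> w -> cycle_edge w z -> cycle_edge (p w) z.
  by move=> /Fn/pK {2}<- wz; apply: pE; rewrite ?FT.
apply: (cycle_common_neighbour k_gt2 pw_neq_w); apply: pw_adj.
- move=> /(congr1 (@nat_of_ord _)); rewrite val_ordS.
  by case: eqP; lia.
- by constructor 2.
- move=> w_fix; have := ord_predK w; rewrite w_fix.
  move=> /(congr1 (@nat_of_ord _)); rewrite val_ordS.
  by case: eqP; lia.
- by constructor 3; rewrite ord_predK.
Qed.

Definition initial_segment k n : set (cycle_graph k) :=
  [set i : 'I_k | i <= n].

Lemma initial_segment_point_by_point k :
  point_by_point (initial_segment (k := k.+1)).
Proof.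
split.
- by apply/seteqP; split=> // i _; exists (nat_of_ord i) => //; exact: leqnn.
- have -> : initial_segment (k := k.+1) 0 = [set ord0].
    apply/seteqP; split=> i; rewrite /initial_segment /=; last by move=> ->.
    by rewrite leqn0 => /eqP i0; apply: val_inj.
  by rewrite card_set1.
- by move=> n i /= /leqW.
(* Nothing is added once the segment has exhausted the cycle. *)
- move=> n; have [->|/set0P[w Dw]] :=
    eqVneq (initial_segment (k := k.+1) n.+1 `\` initial_segment n) set0.
    exact: card_ge0.
  suff -> : initial_segment (k := k.+1) n.+1 `\` initial_segment n = [set w].
    by have /card_eqPle[] := card_set1 (x := w).
  apply/seteqP; split=> [z|z ->//].
  move: Dw => [] /= w1 w2 [] /= z1 z2; apply: val_inj.
  by move: w1 w2 z1 z2; rewrite /initial_segment /=; lia.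
Qed.

Definition fold_onto_segment k n (i : 'I_k.+2) : 'I_k.+2 :=
  if i <= n then i else if n == 0 then ord0 else Ordinal (isT : 1 < k.+2).

(** The boolean [n != 0], read as a number, is the vertex 0 or 1 that receives the fold. *)
Lemma val_fold_onto_segment k n (i : 'I_k.+2) :
  fold_onto_segment n i = (if i <= n then i : nat else n != 0) :> nat.
Proof. by rewrite /fold_onto_segment; case: leqP => //; case: eqP. Qed.

(** The cycle has 3 or 4 points. The delicate case is [n = 2] in the 4-cycle: the new point 3 has
    neighbours 0 and 2, both adjacent to its image 1. Once the segment is everything, the map is the
    identity. *)
Lemma fold_onto_segment_retraction k n : 0 < k < 3 ->
  retraction (X := cycle_graph k.+2)
    (initial_segment n.+1) (initial_segment n) (@fold_onto_segment k n).
Proof.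
move=> k_bounds; split; first by move=> i /= /leqW.
  split=> [i _|i j].
    rewrite /initial_segment /= val_fold_onto_segment.
    by case: (leqP i n) => // _; case: n.
  rewrite /initial_segment /= => i_le j_le.
  rewrite !cycle_edge_val !val_fold_onto_segment.
  move: (ltn_ord i) (ltn_ord j) i_le j_le.
  move: (nat_of_ord i) (nat_of_ord j) => a b.
  by case: (leqP a n) => ?; case: (leqP b n) => ?; case: (eqVneq n 0); lia.
by move=> i; rewrite /initial_segment /fold_onto_segment /= => ->.
Qed.

Lemma cycle3_complete (i j : 'I_3) : cycle_edge i j.
Proof.
by rewrite cycle_edge_val; move: (ltn_ord i) (ltn_ord j); lia.
Qed.

Theorem proposition6p4 (k : nat) (hk : 2 < k) :
  (PPR (cycle_graph k) <-> k < 5) /\ (sociable (cycle_graph k) <-> k = 3).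
Proof.
split; split.
- move=> [F [pbpF retF]].
  have [n [w [_ last]]] := cycle_last_step hk pbpF.
  by have [p /last[]] := retF n.
- case: k hk => [|[|k]] // k_gt2 k_lt5.
  exists (initial_segment (k := k.+2)).
  split=> [|n]; first exact: initial_segment_point_by_point.
  by exists (@fold_onto_segment k n); apply: fold_onto_segment_retraction; lia.
- move=> [F [pbpF socF]].
  have [n [w [Dw last]]] := cycle_last_step hk pbpF.
  by have [p [/last[_ k3] /(_ _ Dw)/k3]] := socF n.
- move=> ->; exists (initial_segment (k := 3)).
  split=> [|n]; first exact: initial_segment_point_by_point.
  exists (@fold_onto_segment 1 n).
  split; first exact: fold_onto_segment_retraction.
  by move=> w _; apply: cycle3_complete.
Qed.
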